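(* For every $n \in \mathbb{N}$, there is a (finite, simple, undirected) graph $G$ with $\chi(G) \geq n$ and $\omega(G) \leq 3$ such that every induced subgraph $H$ of $G$ with $\omega(H) \leq 2$ satisfies $\chi(H) \leq 4$.
   Context: $\chi$ denotes chromatic number and $\omega$ denotes clique number. *)

(* Defs.v *)
From mathcomp Require Import all_boot.
Set Implicit Arguments. Unset Strict Implicit. Unset Printing Implicit Defensive.

Record sgraph := SGraph {
  vertex :> finType;
  adj : rel vertex;
  adj_sym : symmetric adj;
  adj_irrefl : irreflexive adj }.

(* Induced subgraphs of G are given by vertex subsets S : {set G}. *)

Definition clique_in (G : sgraph) (S K : {set G}) : bool :=
  (K \subset S) && [forall x in K, forall y in K, (x != y) ==> adj x y].

Definition omega_in (G : sgraph) (S : {set G}) : nat :=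
  \max_(K : {set G} | clique_in S K) #|K|.

Definition colorable_in (G : sgraph) (S : {set G}) (k : nat) : bool :=
  [exists c : {ffun G -> 'I_k},
     [forall x in S, forall y in S, adj x y ==> (c x != c y)]].

Lemma colorable_in_card (G : sgraph) (S : {set G}) : exists k, colorable_in S k.
Proof.
exists #|vertex G|; apply/existsP; exists [ffun x => enum_rank x].
apply/forallP => x; apply/implyP => _; apply/forallP => y; apply/implyP => _.
apply/implyP => hxy; rewrite !ffunE; apply/negP => /eqP /enum_rank_inj exy.
by subst; rewrite adj_irrefl in hxy.
Qed.

Definition chi_in (G : sgraph) (S : {set G}) : nat :=
  ex_minn (colorable_in_card S).

Definition omega (G : sgraph) := omega_in [set: G].
Definition chi (G : sgraph) := chi_in [set: G].

(* Main.v *)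
Require Import Defs.
From mathcomp Require Import all_boot.
Set Implicit Arguments. Unset Strict Implicit. Unset Printing Implicit Defensive.

(** Take a finite strict order with an additive length [len x y] on pairs
    [x < y], and join [x < y] by an edge when [3] does not divide [len x y].
    A clique is a chain, and lengths measured from its least element are
    pairwise distinct modulo [3], so cliques have at most three vertices.
    If [x < y < z] with both lengths congruent to [1], or both to [2], then
    [x, y, z] is a triangle.  Hence in a triangle-free induced subgraph, for each
    residue [r] in [{1, 2}], colouring [x] by whether it is the lower end of an
    edge of residue [r] is proper on those edges, and the two 2-colourings combine
    to a 4-colouring.  Large chromatic number comes from a Zykov-type
    construction: put below [n] copies of an order of chromatic number [n] a new
    point for each choice of one vertex per copy, at length [1] from the
    chosen vertices; an [n]-colouring would use all colours in every copy, hence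
    all of them on some choice. *)

Record measured_order := MeasuredOrder {
  point :> finType;
  below : rel point;
  len : point -> point -> nat;
  below_irr : irreflexive below;
  below_trans : transitive below;
  len_add : forall x y z, below x y -> below y z -> len x z = len x y + len y z }.

Section ZykovStep.
Variables (n : nat) (P : measured_order).

Definition zykov_point : finType := (('I_n * P) + {ffun 'I_n -> P})%type.

Definition zykov_below (a b : zykov_point) : bool :=
  match a, b with
  | inl (i, x), inl (j, y) => (i == j) && below x y
  | inr f, inl (i, y) => (f i == y) || below (f i) y
  | _, inr _ => false
  end.

(** Additivity dictates [(len (f i) y).+1] above a chosen vertex; the chosen vertex itself is a
    separate case because [len v v] is unconstrained. *)
Definition zykov_len (a b : zykov_point) : nat :=
  match a, b with
  | inl (i, x), inl (j, y) => len x y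
  | inr f, inl (i, y) => if f i == y then 1 else (len (f i) y).+1
  | _, inr _ => 0
  end.

Lemma zykov_below_irr : irreflexive zykov_below.
Proof. by case=> [[i x]|f] //=; rewrite below_irr andbF. Qed.

Lemma zykov_below_trans : transitive zykov_below.
Proof.
move=> [[j y]|g] [[i x]|f] [[k z]|h] //=.
- move=> /andP[/eqP -> xy] /andP[/eqP -> yz].
  by rewrite eqxx (below_trans xy yz).
- move=> /orP[/eqP <-|fy] /andP[/eqP <- yz]; first by rewrite yz orbT.
  by rewrite (below_trans fy yz) orbT.
Qed.

Lemma zykov_len_add a b c :
  zykov_below a b -> zykov_below b c ->
  zykov_len a c = zykov_len a b + zykov_len b c.
Proof.
case: a b c => [[i x]|f] [[j y]|g] [[k z]|h] //=.
- by move=> /andP[_ xy] /andP[_ yz]; apply: len_add.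
- move=> fy /andP[/eqP <- yz].
  have [<-|ney] := eqVneq y (f j).
    by case: eqP => // yz'; rewrite yz' below_irr in yz.
  move: fy; rewrite eq_sym (negPf ney) /= => fy.
  case: eqP => [fz|_]; last by rewrite (len_add fy yz).
  by move: (below_trans fy yz); rewrite fz below_irr.
Qed.

Definition zykov : measured_order :=
  MeasuredOrder zykov_below_irr zykov_below_trans zykov_len_add.

End ZykovStep.

Definition unit_proper (P : measured_order) (C : eqType) (c : P -> C) :=
  forall x y, below x y -> len x y = 1 -> c x != c y.

(** Counting the colours used, not those available, lets the bound apply to each copy inside a
    larger coloured order. *)
Definition needs_colors (P : measured_order) (n : nat) :=
  forall (C : finType) (c : P -> C), unit_proper c -> n <= #|[set c x | x : P]|.

Lemma zykov_needs_colors (P : measured_order) n :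
  needs_colors P n -> needs_colors (zykov n P) n.+1.
Proof.
move=> HP C c cP; set A := [set c x | x : _].
have sub i : [set c (inl (i, v)) | v : P] \subset A.
  by apply/subsetP => a /imsetP[v _ ->]; apply: imset_f.
have copy i : n <= #|[set c (inl (i, v)) | v : P]|.
  apply: (HP C (fun v => c (inl (i, v)))) => x y xy l1.
  by apply: cP => //=; rewrite eqxx.
have leA : n <= #|A|.
  have [->//|n_gt0] := posnP n.
  exact: leq_trans (copy (Ordinal n_gt0)) (subset_leq_card (sub _)).
rewrite ltn_neqAle leA andbT; apply/eqP => e.
(* If [A] had only [n] colours, each copy would use all of them, so copy [i] has a vertex of the
   [i]-th colour of [A]. *)
have [f fP] : exists f : 'I_n -> P,
    forall i, c (inl (i, f i)) = enum_val (cast_ord e i).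
  apply: (fin_all_exists (P := fun i v =>
    c (inl (i, v)) = enum_val (cast_ord e i))) => i.
  have/eqP eqA : [set c (inl (i, v)) | v : P] == A.
    by rewrite eqEcard sub -e copy.
  have: enum_val (cast_ord e i) \in [set c (inl (i, v)) | v : P].
    by rewrite eqA; apply: enum_valP.
  by case/imsetP=> v _ ->; exists v.
pose new : zykov n P := inr (finfun f).
have newA : c new \in A by apply: imset_f.
(* The index of the colour of [new]: the vertex chosen in this copy has that same colour, yet lies
   at length 1 from [new]. *)
pose i := cast_ord (esym e) (enum_rank_in newA (c new)).
have := cP new (inl (i, f i)).
by rewrite /= ffunE eqxx fP cast_ordKV enum_rankK_in // eqxx => /(_ isT erefl).
Qed.

Lemma exists_needs_colors n : exists P, needs_colors P n.
Proof.
elim: n => [|n [P HP]]; last by exists (zykov n P); apply: zykov_needs_colors.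
have irr : irreflexive (fun _ _ : unit => false) by [].
have tr : transitive (fun _ _ : unit => false) by [].
by exists (MeasuredOrder (len := fun _ _ => 0) irr tr
  (fun _ _ _ F _ => match notF F with end)).
Qed.

Section MeasuredGraph.
Variable P : measured_order.

Definition arc (x y : P) := below x y && (len x y %% 3 != 0).
Definition measured_adj (x y : P) := arc x y || arc y x.

Lemma measured_adj_sym : symmetric measured_adj.
Proof. by move=> x y; rewrite /measured_adj orbC. Qed.

Lemma measured_adj_irr : irreflexive measured_adj.
Proof. by move=> x; rewrite /measured_adj /arc below_irr. Qed.

Definition measured_graph := SGraph measured_adj_sym measured_adj_irr.

Lemma chain_min (K : {set P}) x0 : x0 \in K ->
  {in K &, forall x y, x != y -> below x y || below y x} ->
  exists2 u, u \in K & {in K, forall x, x != u -> below u x}.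
Proof.
move=> x0K chain; pose rk (x : P) := #|[set y | below y x]|.
(* An element of [K] below [u] would have strictly fewer elements of [P] below it, by transitivity
   and irreflexivity. *)
case: (arg_minnP rk x0K) => u uK umin; exists u => // x xK xu.
case/orP: (chain x u xK uK xu) => // x_u.
suff: rk x < rk u by rewrite ltnNge umin.
apply/proper_card/properP; split.
  by apply/subsetP => y; rewrite !inE => /below_trans; apply.
by exists x; rewrite !inE // below_irr.
Qed.

Lemma measured_cliqueP (S K : {set measured_graph}) : clique_in S K ->
  K \subset S /\ {in K &, forall x y, x != y -> measured_adj x y}.
Proof.
case/andP=> KS /forall_inP cl; split=> // x y xK yK.
by have /forall_inP/(_ y yK)/implyP := cl x xK.
Qed.

Lemma measured_omega : omega measured_graph <= 3.
Proof.
apply/bigmax_leqP => K /measured_cliqueP[_ cl].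
have [->|[x0 x0K]] := set_0Vmem K; first by rewrite cards0.
have [|u uK umin] := chain_min x0K.
  by move=> x y xK yK /(cl _ _ xK yK) /orP[] /andP[->] //; rewrite orbT.
pose g (x : P) : 'I_3 := if x == u then ord0 else inord (len u x %% 3).
have g_val x : g x = (if x == u then 0 else len u x %% 3) :> nat.
  by rewrite /g; case: ifP => // _; rewrite inordK // ltn_mod.
(* Passing from [x] to [y] adds [len x y], nonzero modulo 3, to the length from [u]. *)
have g_arc x y : x \in K -> arc x y -> g x != g y.
  move=> xK /andP[xy l3]; apply/negP => /eqP/(congr1 val); rewrite /= !g_val.
  have [xu|xu] := eqVneq x u.
    rewrite -xu; case: eqP => [yx|_ e]; first by rewrite yx below_irr in xy.
    by rewrite -e in l3.
  have ux := umin x xK xu.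
  case: eqP => [yu|_].
    by move: (below_trans ux xy); rewrite yu below_irr.
  rewrite (len_add ux xy) => /eqP; rewrite -[X in X %% 3 == _]addn0 eqn_modDl.
  by rewrite eq_sym mod0n (negPf l3).
have g_inj : {in K &, injective g}.
  move=> x y xK yK gxy; apply/eqP/negPn/negP => /(cl _ _ xK yK) /orP[] a.
    by move: (g_arc _ _ xK a); rewrite gxy eqxx.
  by move: (g_arc _ _ yK a); rewrite gxy eqxx.
rewrite -(card_in_imset g_inj); apply: leq_trans (max_card _) _.
by rewrite card_ord.
Qed.

Lemma measured_chi n : needs_colors P n -> n <= chi measured_graph.
Proof.
move=> HP; rewrite /chi /chi_in; case: ex_minnP => k /existsP[c /forall_inP cP] _.
have cu : unit_proper (c : P -> 'I_k).
  move=> x y xy l1; have /forall_inP/(_ y (in_setT y)) := cP x (in_setT x).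
  by move/implyP; apply; rewrite /= /measured_adj /arc xy l1.
apply: leq_trans (HP _ _ cu) _; apply: leq_trans (max_card _) _.
by rewrite card_ord.
Qed.

Definition lower_end (S : {set P}) r x :=
  [exists y in S, below x y && (len x y %% 3 == r)].

Lemma triangle_free_lower_end (S : {set measured_graph}) r x y :
  omega_in S <= 2 -> r \in [:: 1; 2] -> x \in S -> y \in S ->
  below x y -> len x y %% 3 = r -> lower_end S r x && ~~ lower_end S r y.
Proof.
move=> w2 r12 xS yS xy lxy; apply/andP; split.
  by apply/exists_inP; exists y; rewrite // xy lxy /=.
apply/negP => /exists_inP[z zS /andP[yz /eqP lyz]].
have xz := below_trans xy yz.
have r_neq0 : r != 0 by move: r12; rewrite !inE => /orP[] /eqP->.
have lxz : len x z %% 3 != 0.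
  (* Modulo 3, 1 + 1 is 2 and 2 + 2 is 1, so the third side is an arc too. *)
  rewrite (len_add xy yz) -modnDm lxy lyz.
  by move: r12; rewrite !inE => /orP[] /eqP->.
have Axy : arc x y by rewrite /arc xy lxy.
have Ayz : arc y z by rewrite /arc yz lyz.
have Axz : arc x z by rewrite /arc xz.
have neq (a b : P) : below a b -> a != b.
  by move=> ab; apply/eqP => e; rewrite e below_irr in ab.
suff: 3 <= omega_in S by rewrite leqNgt ltnS w2.
pose K : {set measured_graph} := [set x; y; z].
have K3 : #|K| = 3.
  rewrite /K setUC cardsU1 cards2 !inE (neq _ _ xy).
  by rewrite ![z == _]eq_sym (negPf (neq _ _ xz)) (negPf (neq _ _ yz)).
rewrite -K3; apply: (leq_bigmax_cond (F := fun K : {set measured_graph} => #|K|)).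
apply/andP; split.
  by apply/subsetP => a; rewrite !inE => /orP[/orP[]|] /eqP->.
apply/forall_inP => a aK; apply/forall_inP => b bK; apply/implyP.
move: aK bK; rewrite !inE /= /measured_adj.
by case/orP=> [/orP[]|] /eqP->; case/orP=> [/orP[]|] /eqP->;
   rewrite ?eqxx ?Axy ?Ayz ?Axz ?orbT.
Qed.

Lemma measured_triangle_free_chi (S : {set measured_graph}) :
  omega_in S <= 2 -> chi_in S <= 4.
Proof.
move=> w2; rewrite /chi_in; case: ex_minnP => k _; apply.
have col_lt (a b : bool) : a + b.*2 < 4 by case: a b => [] [].
(* The two bits are read as a binary number below 4. *)
apply/existsP; exists [ffun x => Ordinal (col_lt (lower_end S 1 x) (lower_end S 2 x))].
have arc_neq x y : x \in S -> y \in S -> arc x y ->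
    (lower_end S 1 x, lower_end S 2 x) != (lower_end S 1 y, lower_end S 2 y).
  move=> xS yS /andP[xy l3].
  have r12 : len x y %% 3 \in [:: 1; 2].
    by move: l3 (ltn_pmod (len x y) (isT : 0 < 3)); case: (_ %% _) => [|[|[]]].
  (* The bit for the residue of the arc is true at [x] and false at [y]. *)
  have := triangle_free_lower_end w2 r12 xS yS xy erefl.
  move: r12; rewrite !inE xpair_eqE => /orP[] /eqP->; case/andP=> -> /negPf->.
    by [].
  by rewrite andbF.
apply/forall_inP => x xS; apply/forall_inP => y yS; apply/implyP => adjxy.
rewrite !ffunE -val_eqE /=.
have: (lower_end S 1 x, lower_end S 2 x) != (lower_end S 1 y, lower_end S 2 y).
  by case/orP: adjxy => /arc_neq; [|rewrite eq_sym]; apply.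
(* Sixteen cases confirm that the binary encoding is injective. *)
by do 4!case: (lower_end _ _ _).
Qed.

End MeasuredGraph.

Theorem theorem1p3 : forall n : nat, exists G : sgraph,
  n <= chi G /\ omega G <= 3 /\
  (forall S : {set G}, omega_in S <= 2 -> chi_in S <= 4).
Proof.
move=> n; have [P HP] := exists_needs_colors n.
exists (measured_graph P); split; first exact: measured_chi.
by split; [exact: measured_omega | exact: measured_triangle_free_chi].
Qed.
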